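(* Let $\gamma\ge0$ and let $\nu$ be a probability measure on $\mathbb{R}\times\mathbb{R}^p$. The (generalized) Poisson hyperplane process $\mathrm{Poisson}(\gamma,\nu)(u)$ defined on $\mathbb{R}^p$ is even if $\nu(A\times B)=\nu(A\times(-B))$ for all Borel measurable sets $A\subseteq\mathbb{R}$, $B\subseteq\mathbb{R}^p$. Hence, if $\nu(A\times B)=\nu(A\times(-B))$ for all Borel measurable $A\subseteq\mathbb{R}$, $B\subseteq\mathbb{R}^p$, then the centered Poisson hyperplane process $\mathbb{S}(u)=\mathrm{cPoisson}(\gamma,\nu)(u)$ is even; and if in addition the deterministic function $u\mapsto\mathbb{D}(u)+\mathbb{X}(u)$ is even and $W=\arg\min_{u\in\mathbb{R}^p}\,\mathbb{D}(u)+\mathrm{cPoisson}(\gamma,\nu)(u)+\mathbb{X}(u)$ exists and is unique almost surely, then $W\overset{d}{=}-W$.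
   Context: Poisson hyperplane process: let $\{\tau_i\}_{i\ge1}$ be the jump times of a Poisson process with parameter $\gamma$, i.e. $\tau_1$ and $\tau_{i+1}-\tau_i$, $i\ge1$, are IID exponential random variables with expectation $1/\gamma$ (if $\gamma=0$ there are no jumps and the process is identically zero). Let $(V_i,U_i)_{i\ge1}$ be an IID sequence of random vectors in $\mathbb{R}\times\mathbb{R}^p$ distributed according to $\nu$, independent of $\{\tau_i\}_{i\ge1}$. Then $\mathrm{Poisson}(\gamma,\nu)(u)=\sum_{i=1}^\infty V_i\mathbf{1}\{\tau_i\le\langle u,U_i\rangle\}$, $u\in\mathbb{R}^p$, and $\mathrm{cPoisson}(\gamma,\nu)(u)=\mathrm{Poisson}(\gamma,\nu)(u)-\mathbb{E}[\mathrm{Poisson}(\gamma,\nu)(u)]$, where $\mathbb{E}[\mathrm{Poisson}(\gamma,\nu)(u)]=\gamma\int y\,(\langle u,s\rangle)_+\,d\nu(y,s)$. It is implicit that $\nu$ is such that the sums and the expectations are well defined and finite. A stochastic process $u\mapsto\mathbb{S}(u)$ on $\mathbb{R}^p$ is called even if $u\mapsto\mathbb{S}(u)$ and $u\mapsto\mathbb{S}(-u)$ share the same law, i.e. for all $k\ge1$ and $u_1,\dots,u_k\in\mathbb{R}^p$, $(\mathbb{S}(u_1),\ldots,\mathbb{S}(u_k))\overset{d}{=}(\mathbb{S}(-u_1),\ldots,\mathbb{S}(-u_k))$; a deterministic function $f$ is even if $f(-u)=f(u)$ for all $u$. Here $\mathbb{D}(\cdot)$ is a deterministic non-negative function with a global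 minimum at zero, $\mathbb{D}(0)=0$, and $\mathbb{X}(\cdot)$ is the indicator function of some cone $\Theta^\star\subseteq\mathbb{R}^p$ in the sense of optimization: $\mathbb{X}=0$ on $\Theta^\star$ and $\mathbb{X}=+\infty$ off $\Theta^\star$.
   Formalization: For the claim about W, the deterministic function D(u)+X(u) is additionally assumed Borel measurable; without this the claim W =d -W can fail for a non-measurable even D on a suitable probability space. *)

(* Defs.v *)
From HB Require Import structures.
From mathcomp Require Import all_boot all_order all_algebra finmap.
From mathcomp Require Import all_classical all_reals all_analysis measurable_realfun.

Set Implicit Arguments.
Unset Strict Implicit.
Unset Printing Implicit Defensive.

Import Order.TTheory GRing.Theory Num.Theory.
Import numFieldNormedType.Exports.

Local Open Scope classical_set_scope.
Local Open Scope ring_scope.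

(* R^n with its Borel sigma-algebra. The carrier is 'rV[R]_n. *)
Definition rVborel (R : realType) (n : nat) :=
  g_sigma_algebraType (@open 'rV[R]_n).

Definition dotp (R : realType) (p : nat) (u s : 'rV[R]_p) : R :=
  \sum_(j < p) u 0 j * s 0 j.

Definition neg_set (R : realType) (p : nat) (B : set 'rV[R]_p) : set 'rV[R]_p :=
  [set s | exists2 t, B t & s = - t].

Section Laws.
Context {R : realType} {d : measure_display} {Omega : measurableType d}.
Variable P : probability Omega R.

Definition has_law {d'} {T : measurableType d'} (X : Omega -> T)
    (mu : set T -> \bar R) : Prop :=
  measurable_fun [set: Omega] X /\
  forall B : set T, measurable B -> P (X @^-1` B) = mu B.

Definition eq_in_law {d'} {T : measurableType d'} (X Y : Omega -> T) : Prop :=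
  [/\ measurable_fun [set: Omega] X, measurable_fun [set: Omega] Y &
      forall B : set T, measurable B -> P (X @^-1` B) = P (Y @^-1` B)].

Definition mutually_independent {d'} {T : measurableType d'}
    (X : nat -> Omega -> T) : Prop :=
  forall (J : {fset nat}) (B : nat -> set T),
    (forall i, measurable (B i)) ->
    P (\bigcap_(i in [set` J]) X i @^-1` B i) =
    (\prod_(i <- J) P (X i @^-1` B i))%E.

Definition iid {d'} {T : measurableType d'} (X : nat -> Omega -> T)
    (mu : set T -> \bar R) : Prop :=
  (forall i, has_law (X i) mu) /\ mutually_independent X.

Definition sigma_of_seq {d'} {T : measurableType d'} (X : nat -> Omega -> T) :
    set (set Omega) :=
  <<s \bigcup_i preimage_set_system [set: Omega] (X i) measurable >>.

Definition independent_seqs {d1 d2} {T1 : measurableType d1}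
    {T2 : measurableType d2} (X : nat -> Omega -> T1) (Y : nat -> Omega -> T2) :
    Prop :=
  forall A B : set Omega, sigma_of_seq X A -> sigma_of_seq Y B ->
    P (A `&` B) = (P A * P B)%E.

End Laws.

(* [tau i] is the (i+1)-st jump time. *)
Definition gap (R : realType) (T : Type) (tau : nat -> T -> R) (i : nat)
    (w : T) : R :=
  if i is j.+1 then tau j.+1 w - tau j w else tau 0%N w.

(* [VU i w] is the pair (V_{i+1}, U_{i+1}). For gamma = 0 there are no jumps and
   [tau] is unconstrained, since [Poisson] below does not use it. The measure
   [exponential_prob gamma] has density gamma * exp(- gamma * x) on [0, +oo[,
   hence expectation 1 / gamma. *)
Definition poisson_driver (R : realType) (p : nat) (d : measure_display)
    (Omega : measurableType d) (P : probability Omega R) (gamma : R)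
    (nu : probability (R * rVborel R p)%type R)
    (tau : nat -> Omega -> R) (VU : nat -> Omega -> R * rVborel R p) : Prop :=
  iid P VU nu /\
  (0 < gamma ->
    iid P (gap tau) (exponential_prob gamma) /\ independent_seqs P tau VU).

(* The series is almost surely absolutely convergent and integrable whenever
   [poisson_integrable] holds; elsewhere [limn] takes a default value. *)
Definition Poisson (R : realType) (p : nat) (Omega : Type) (gamma : R)
    (tau : nat -> Omega -> R) (VU : nat -> Omega -> R * rVborel R p)
    (u : 'rV[R]_p) (w : Omega) : R :=
  if gamma == 0 then 0
  else limn (series (fun i : nat =>
    (VU i w).1 * (tau i w <= dotp u (VU i w).2)%R%:R)).

Definition cPoisson (R : realType) (p : nat) (d : measure_display)
    (Omega : measurableType d) (P : probability Omega R) (gamma : R)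
    (tau : nat -> Omega -> R) (VU : nat -> Omega -> R * rVborel R p)
    (u : 'rV[R]_p) (w : Omega) : R :=
  Poisson gamma tau VU u w - fine ('E_P[Poisson gamma tau VU u])%E.

(* The sums and the expectation gamma * \int y (<u,s>)_+ dnu(y,s) are well
   defined and finite; this is no constraint on nu when gamma = 0. *)
Definition poisson_integrable (R : realType) (p : nat) (gamma : R)
    (nu : probability (R * rVborel R p)%type R) : Prop :=
  0 < gamma -> forall u : 'rV[R]_p,
    nu.-integrable [set: R * rVborel R p]
      (fun z => (z.1 * Num.max 0 (dotp u z.2))%:E).

Definition symmetric_second (R : realType) (p : nat)
    (nu : probability (R * rVborel R p)%type R) : Prop :=
  forall (A : set R) (B : set (rVborel R p)), measurable A -> measurable B ->
    nu (A `*` B) = nu (A `*` neg_set B).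

Definition even_process (R : realType) (p : nat) (d : measure_display)
    (Omega : measurableType d) (P : probability Omega R)
    (S : 'rV[R]_p -> Omega -> R) : Prop :=
  forall k : nat, (0 < k)%N -> forall u : 'I_k -> 'rV[R]_p,
    eq_in_law P (T := rVborel R k)
      (fun w => \row_j S (u j) w) (fun w => \row_j S (- u j) w).

Definition even_fun (R : realType) (p : nat) (T : Type) (f : 'rV[R]_p -> T) :
    Prop :=
  forall u, f (- u) = f u.

Definition is_cone (R : realType) (p : nat) (C : set 'rV[R]_p) : Prop :=
  forall (t : R) (u : 'rV[R]_p), 0 < t -> C u -> C (t *: u).

Definition opt_indicator (R : realType) (p : nat) (C : set 'rV[R]_p)
    (u : 'rV[R]_p) : \bar R :=
  (if u \in C then 0 else +oo)%E.

Definition argmin (R : realType) (T : Type) (f : T -> \bar R) : set T :=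
  [set u | forall v, (f u <= f v)%E].

(* Main.v *)
Require Import Defs.
From HB Require Import structures.
From mathcomp Require Import all_boot all_order all_algebra finmap.
From mathcomp Require Import all_classical all_reals all_analysis measurable_realfun.
From mathcomp Require Import borel_hierarchy.

(* Write the process as G (Z, u), where Z = (tau, (V, U)) and G is jointly
   measurable. Since <- u, s> = <u, - s>, replacing u by - u amounts to replacing
   every U_i by - U_i, which preserves the law of Z; evenness and the symmetry of
   the expectation follow. For the argmin, W is in B iff z = Z satisfies "some u in
   B minimizes f (z, .)", and - W is in B iff the reflected z does, so it suffices that
   this set of z's be measurable up to a null set. It is a projection along R^p, so
   this follows from the measurable projection theorem, proved here by writing
   product-measurable sets as Suslin sets and approximating projections
   from inside in measure. *)

Import Order.TTheory GRing.Theory Num.Theory.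
Import numFieldNormedType.Exports.

Local Open Scope classical_set_scope.
Local Open Scope ring_scope.

Set Implicit Arguments.
Unset Strict Implicit.
Unset Printing Implicit Defensive.

(** * Suslin sets *)

(** Dependent choice along finite prefixes: a chosen extension is iterated from the empty sequence,
    and the lists so obtained are the prefixes of one infinite sequence. *)
Lemma seq_choice (P : seq nat -> Prop) :
  P [::] -> (forall s, P s -> exists k, P (rcons s k)) ->
  exists f : nat -> nat, forall n, P (mkseq f n).
Proof.
move=> P0 PS.
have /choice[h hP] : forall s, exists k, P s -> P (rcons s k).
  move=> s; have [Ps|nPs] := pselect (P s); last by exists 0%N.
  by have [k Pk] := PS s Ps; exists k.
pose g := fix g n := if n is m.+1 then rcons (g m) (h (g m)) else [::].
have gE n : g n = mkseq (fun i => h (g i)) n.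
  by elim: n => // n IH /=; rewrite mkseqS {1}IH.
exists (fun i => h (g i)) => n; rewrite -gE.
by elim: n => //= n IH; exact: hP.
Qed.

(** Makes finitely many thresholds or dependence depths uniform. *)
Lemma initial_segment_bound (m : nat) (n : nat -> nat) :
  exists N, forall j, (j < m)%N -> (n j <= N)%N.
Proof.
exists (\max_(j < m) n j)%N => j jm.
exact: (@leq_bigmax _ (fun j : 'I_m => n j) (Ordinal jm)).
Qed.

Section suslin.
Context {d : measure_display} {X : measurableType d} {Y : topologicalType}.

(** The Suslin operation, with pieces indexed by whole branches [f], of which piece [j] sees only
    the first [n j] entries. Leaving the depth [n] free, instead of fixing it to [j], lets branches
    be recoded without refining the pieces. *)
Definition suslin_scheme (F : nat -> (nat -> nat) -> set X)
    (K : nat -> (nat -> nat) -> set Y) (n : nat -> nat) (A : set (X * Y)) :=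
  [/\ forall j f, measurable (F j f),
      forall j f, closed (K j f),
      forall j f g, (forall i, (i < n j)%N -> f i = g i) ->
        F j f = F j g /\ K j f = K j g &
      forall x y, A (x, y) <-> exists f, forall j, F j f x /\ K j f y].

Definition suslin (A : set (X * Y)) := exists F K n, suslin_scheme F K n A.

Lemma suslin_setX (F : set X) (K : set Y) :
  measurable F -> closed K -> suslin (F `*` K).
Proof.
move=> mF cK; exists (fun _ _ => F), (fun _ _ => K), (fun=> 0%N); split => // x y.
by split=> [[Fx Ky]|[f /(_ 0%N)//]]; exists id.
Qed.

(** Numbers that code no pair decode to [(0, 0)] and so only repeat a condition already imposed. *)
Let dec (m : nat) : nat * nat := odflt (0, 0)%N (choice.unpickle m).

Let decK p : dec (choice.pickle p) = p.
Proof. by rewrite /dec choice.pickleK. Qed.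

(** Entry 0 of a branch selects the set [A k], and its tail is a branch for that set. Condition
    [(k, j)] is trivial unless [k] is the selected index. *)
Lemma suslin_bigcup (A : (set (X * Y))^nat) :
  (forall k, suslin (A k)) -> suslin (\bigcup_k A k).
Proof.
move=> /choice[F] /choice[K] /choice[n] H.
pose sh (f : nat -> nat) i := f i.+1.
exists (fun m f => if f 0%N == (dec m).1 then F (dec m).1 (dec m).2 (sh f) else setT).
exists (fun m f => if f 0%N == (dec m).1 then K (dec m).1 (dec m).2 (sh f) else setT).
exists (fun m => (n (dec m).1 (dec m).2).+1); split.
- by move=> j f; case: ifP => // _; case: (H (dec j).1) => + _ _ _; exact.
- move=> j f; case: ifP => // _.
  by case: (H (dec j).1) => _ + _ _; exact.
- move=> j f g fg; rewrite -(fg 0%N)//; case: ifP => // _.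
  by case: (H (dec j).1) => _ _ + _; apply=> i ij; exact: fg.
move=> x y; split.
  move=> [k _]; have [_ _ _ ->] := H k; move=> [f fP].
  exists (fun i => if i is i'.+1 then f i' else k) => m /=.
  by case: ifP => // /eqP <-; exact: fP.
move=> [f fP]; exists (f 0%N) => //; have [_ _ _ ->] := H (f 0%N).
by exists (sh f) => j; have := fP (choice.pickle (f 0%N, j)); rewrite decK /= eqxx.
Qed.

(** A single branch codes one branch for each [A k], through the coding of pairs [(k, i)]. Condition
    [(k, j)] reads only the branch number [k]. *)
Lemma suslin_bigcap (A : (set (X * Y))^nat) :
  (forall k, suslin (A k)) -> suslin (\bigcap_k A k).
Proof.
move=> /choice[F] /choice[K] /choice[n] H.
pose sh (k : nat) (f : nat -> nat) (i : nat) := f (choice.pickle (k, i)).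
exists (fun m f => F (dec m).1 (dec m).2 (sh (dec m).1 f)).
exists (fun m f => K (dec m).1 (dec m).2 (sh (dec m).1 f)).
exists (fun m => \max_(i < n (dec m).1 (dec m).2) (choice.pickle ((dec m).1, i : nat)).+1)%N.
split.
- by move=> j f; case: (H (dec j).1) => + _ _ _; exact.
- by move=> j f; case: (H (dec j).1) => _ + _ _; exact.
- move=> j f g fg; case: (H (dec j).1) => _ _ + _; apply=> i ij; apply: fg.
  exact: (@leq_bigmax _ (fun i : 'I__ => (choice.pickle ((dec j).1, i : nat)).+1)
                        (Ordinal ij)).
move=> x y; split.
  move=> Axy; have /choice[f fP] : forall k, exists f, forall j, F k j f x /\ K k j f y.
    by move=> k; have [_ _ _ <-] := H k; exact: Axy.
  exists (fun m => f (dec m).1 (dec m).2) => m.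
  suff -> : sh (dec m).1 (fun m => f (dec m).1 (dec m).2) = f (dec m).1 by exact: fP.
  by apply/funext => i; rewrite /sh decK.
move=> [f fP] k _; have [_ _ _ ->] := H k.
by exists (sh k f) => j; have := fP (choice.pickle (k, j)); rewrite decK.
Qed.

End suslin.

(** Suslin sets need not be closed under complement, so the sigma-algebra used is that of the sets
    that are Suslin together with their complement. Open sets enter as countable unions of closed
    ones, and their complements are closed. *)
Lemma measurable_suslin {d : measure_display} {X : measurableType d}
    {Y : ptopologicalType} (A : set (X * g_sigma_algebraType (@open Y))) :
  (forall U : set Y, open U -> Fsigma U) ->
  measurable A -> suslin (A : set (X * Y)).
Proof.
move=> openF.
pose S := [set A : set (X * Y) | suslin A /\ suslin (~` A)].
have S0 : S set0.
  split; last first.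
    rewrite setC0 -setXTT.
    by apply: suslin_setX => //; exact: closedT.
  rewrite -(set0X setT); apply: suslin_setX => //; exact: closedT.
have SC B : S B -> S (~` B) by move=> [? ?]; split => //; rewrite setCK.
have SU (B : (set (X * Y))^nat) : (forall k, S (B k)) -> S (\bigcup_k B k).
  move=> SB; split; first by apply: suslin_bigcup => k; case: (SB k).
  by rewrite setC_bigcup; apply: suslin_bigcap => k; case: (SB k).
have SS : sigma_algebra setT S.
  by split => // B SB; rewrite setTD; exact: SC.
suff : (measurable : set (set (X * g_sigma_algebraType (@open Y)))) `<=` S
  by move=> h /h [].
rewrite measurable_prod_measurableType; apply: smallest_sub => //.
move=> _ [B mB] [C mC <-].
have SX : S (B `*` setT).
  split; first by apply: suslin_setX => //; exact: closedT.
  suff -> : ~` (B `*` setT) = (~` B) `*` setT :> set (X * Y).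
    by apply: suslin_setX; [exact: measurableC|exact: closedT].
  by apply/seteqP; split => -[x y] /=; tauto.
have SY : S (setT `*` C).
  pose S' := [set C : set Y | S (setT `*` C)].
  suff : (measurable : set (set (g_sigma_algebraType (@open Y)))) `<=` S' by exact.
  apply: smallest_sub.
    split.
    - by rewrite /S' /= setX0.
    - move=> D; rewrite /S' /= setTD => /SC.
      suff -> : ~` (setT `*` D) = setT `*` (~` D) :> set (X * Y) by [].
      by apply/seteqP; split => -[x y] /=; tauto.
    - by move=> D SD; rewrite /S' /= setX_bigcupr; exact: SU.
  move=> U oU; split.
    have [G cG ->] := openF U oU.
    rewrite setX_bigcupr; apply: suslin_bigcup => k.
    by apply: suslin_setX => //; exact: cG.
  suff -> : ~` (setT `*` U) = setT `*` (~` U) :> set (X * Y).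
    by apply: suslin_setX => //; exact: open_closedC.
  by apply/seteqP; split => -[x y] /=; tauto.
have -> : B `*` C = ~` (~` (B `*` setT) `|` ~` (setT `*` C)) :> set (X * Y).
  by rewrite -setCI setCK; apply/seteqP; split => -[x y] /= => [[]|[[? _] []]].
apply/SC; rewrite -bigcup2E; apply: SU => -[|[|k]] //=; exact: SC.
Qed.

(** * Measurable projection *)

Section projection.
Context {d : measure_display} {X : measurableType d} {R : realType}.
Variable mu : {measure set X -> \bar R}.
Hypothesis mu_fin : (mu setT < +oo)%E.

(* [A] has outer measure at most [c]. *)
Definition thin (c : R) (A : set X) :=
  exists U, [/\ measurable U, A `<=` U & (mu U <= c%:E)%E].

Lemma thin_subset c A B : A `<=` B -> thin c B -> thin c A.
Proof. by move=> AB [U [mU BU Uc]]; exists U; split => // x /AB /BU. Qed.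

(** The covers of the [A n] need not increase. Intersecting each with all later ones makes them
    increase, and they still cover because [A] increases; continuity from below then bounds the
    union. *)
Lemma thin_bigcup c (A : (set X)^nat) : (forall n, A n `<=` A n.+1) ->
  (forall n, thin c (A n)) -> thin c (\bigcup_n A n).
Proof.
move=> Aincr /choice[U UP].
pose V n := \bigcap_k U (n + k)%N.
have mV n : measurable (V n).
  by apply: bigcapT_measurable => k; case: (UP (n + k)%N).
have mUV : measurable (\bigcup_n V n) by exact: bigcupT_measurable.
have AleA n k : A n `<=` A (n + k)%N.
  elim: k => [|k IH]; first by rewrite addn0.
  by rewrite addnS; exact: (subset_trans IH).
exists (\bigcup_n V n); split => //.
  move=> x [n _ Anx]; exists n => // k _.
  by case: (UP (n + k)%N) => _ + _; apply; exact: AleA.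
have Vincr : {homo V : n m / (n <= m)%N >-> (n <= m)%O}.
  apply/nondecreasing_seqP => n; rewrite subsetEset => x Vx k _.
  by rewrite addSnnS; exact: Vx.
have cV := nondecreasing_cvg_mu (mu := mu) mV mUV Vincr.
rewrite -(cvg_lim _ cV)//; apply: lime_le; first by apply/cvg_ex; exists (mu (\bigcup_n V n)).
near=> n; case: (UP n) => mU _; apply: le_trans.
apply: le_measure; rewrite ?inE// => x /(_ 0%N I).
by rewrite addn0.
Unshelve. all: by end_near. Qed.

(** Compactness of the set of sequences bounded by [g]: [h] is built so that each of its prefixes is
    shared by infinitely many [f m]. *)
Lemma konig (f : nat -> nat -> nat) (g : nat -> nat) :
  (forall m i, (f m i <= g i)%N) ->
  exists h, forall n m, exists2 m', (m <= m')%N & forall i, (i < n)%N -> f m' i = h i.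
Proof.
move=> fg.
have [||h hP] := @seq_choice (fun s => forall m, exists2 m', (m <= m')%N &
  forall i, (i < size s)%N -> f m' i = nth 0%N s i).
- by move=> m; exists m.
- move=> s sP; apply: contrapT => /forallNP nk.
  have /choice[M MP] : forall k, exists m, forall m', (m <= m')%N ->
      ~ forall i, (i < size (rcons s k))%N -> f m' i = nth 0%N (rcons s k) i.
    move=> k; have /existsNP[m /forall2NP mP] := nk k.
    by exists m => m' mm'; case: (mP m').
  (* The next entry takes at most [g (size s) + 1] values, so beyond one common threshold none of
     them would extend [s]. A late [f m'] that agrees with [s] contradicts this. *)
  have [N NP] := initial_segment_bound (g (size s)).+1 M.
  have [m' Nm' m's] := sP N.
  apply: (MP (f m' (size s)) m'); first by rewrite (leq_trans _ Nm')// NP// ltnS.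
  move=> i; rewrite size_rcons nth_rcons ltnS leq_eqVlt => /orP[/eqP->|lis].
    by rewrite ltnn eqxx.
  by rewrite lis m's.
exists h => n m; have [m' mm' m'P] := hP n m; exists m' => // i ni.
by move: m'P; rewrite size_mkseq => ->; rewrite ?nth_mkseq.
Qed.

Context {Y : topologicalType} (B : (set Y)^nat).
Hypotheses (cptB : forall n, compact (B n)) (incrB : forall n, B n `<=` B n.+1)
  (covB : \bigcup_n B n = setT).

(* If [A] is not thin, neither is the projection of the part of [A] with
   parameters bounded by a suitable [g] and second coordinate in some [B n]; by
   compactness that projection is a decreasing limit of measurable sets. *)
Lemma suslin_proj_inner c (A : set (X * Y)) : suslin A ->
  ~ thin c [set x | exists y, A (x, y)] ->
  exists L, [/\ measurable L, L `<=` [set x | exists y, A (x, y)] &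
                (c%:E <= mu L)%E].
Proof.
move=> [F [K [n [mF cK dep AE]]]] nA.
(* The [B n] increase to the whole space, and an increasing union of [thin c] sets is [thin c], so a
   single [B n0] already gives a projection that is not thin. *)
have [n0 nAn0] : exists n0, ~ thin c [set x | exists2 y, B n0 y & A (x, y)].
  apply/existsNP => tA; apply: nA.
  pose Pr k := [set x | exists2 y, B k y & A (x, y)].
  suff -> : [set x | exists y, A (x, y)] = \bigcup_k Pr k.
    by apply: thin_bigcup => // k x [y By Ay]; exists y => //; exact: incrB.
  apply/seteqP; split => x; last by move=> [k _ [y _ Ay]]; exists y.
  move=> [y Ay]; have [k _ By] : (\bigcup_n B n) y by rewrite covB.
  by exists k => //; exists y.
pose S s := [set x | exists y f, [/\ B n0 y,
  forall i, (i < size s)%N -> (f i <= nth 0 s i)%N &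
  forall j, F j f x /\ K j f y]].
(* [S s] is the increasing union over [k] of the [S (rcons s k)], so every list of bounds has an
   extension that keeps the set from being thin. *)
have [||g gP] := @seq_choice (fun s => ~ thin c (S s)).
- apply: contra_not nAn0; apply: thin_subset => x [y By] /AE[f fP].
  by exists y, f.
- move=> s ns; apply/existsNP => tk; apply: ns.
  suff sub : S s `<=` \bigcup_k S (rcons s k).
    apply: (thin_subset sub); apply: thin_bigcup => // k x [y [f [By fs fP]]].
    exists y, f; split => // i; move: (fs i); rewrite !size_rcons !nth_rcons.
    move=> fsi {}/fsi; case: ifP => // _; case: ifP => // _ /leq_trans; exact.
  move=> x [y [f [By fs fP]]]; exists (f (size s)) => //; exists y, f; split => // i.
  rewrite size_rcons ltnS nth_rcons leq_eqVlt => /orP[/eqP ->|si].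
    by rewrite ltnn eqxx.
  by rewrite si fs.
(* The [D m] decrease with [m], and their intersection will be the inner set. *)
pose D m := [set x | exists f y, [/\ forall i, (f i <= g i)%N, B n0 y &
  forall j, (j < m)%N -> F j f x /\ K j f y]].
have mD m : measurable (D m).
  (* The first [m] conditions see finitely many entries of a branch, so finite sequences padded with
     zeros suffice and the union becomes countable. The constraint on [y] does not involve [x]: it
     only decides whether a piece is kept. *)
  pose G (s : seq nat) := if `[< (forall i, (nth 0 s i <= g i)%N) /\
      exists2 y, B n0 y & forall j, (j < m)%N -> K j (nth 0%N s) y >]
    then \bigcap_j (if (j < m)%N then F j (nth 0%N s) else setT) else set0.
  suff -> : D m = \bigcup_s G s.
    apply: countable_bigcupT_measurable => // s; rewrite /G; case: ifP => // _.
    by apply: bigcapT_measurable => j; case: ifP.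
  apply/seteqP; split => x.
    move=> [f [y [fg By fP]]]; have [N NP] := initial_segment_bound m n.
    have fE j : (j < m)%N -> F j f = F j (nth 0%N (mkseq f N)) /\
        K j f = K j (nth 0%N (mkseq f N)).
      move=> jm; apply: dep => i ij; rewrite nth_mkseq//.
      exact: leq_trans (NP _ jm).
    exists (mkseq f N) => //; rewrite /G ifT.
      move=> j _; case: ifP => // jm; have [<- _] := fE _ jm.
      by case: (fP j jm).
    apply/asboolP; split.
      move=> i; have [iN|Ni] := ltnP i N; first by rewrite nth_mkseq.
      by rewrite nth_default// size_mkseq.
    exists y => // j jm; have [_ <-] := fE _ jm; by case: (fP j jm).
  move=> [s _]; rewrite /G; case: ifPn => // /asboolP[sg [y By yP]] xP.
  exists (nth 0%N s), y; split => // j jm; split; last exact: yP.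
  by have := xP j I; rewrite jm.
(* Zeroing a branch beyond [N] respects every bound and leaves the first [m] conditions intact, so
   [D m] lies in [S (mkseq g N)]. Measure below [c] would thus make [D m] a cover contradicting [gP]
   once this inclusion is read for the witnesses of [S (mkseq g N)]. *)
have Dc m : (c%:E <= mu (D m))%E.
  rewrite leNgt; apply/negP => /ltW Dc.
  have [N NP] := initial_segment_bound m n.
  apply: (gP N); exists (D m); split => // x [y [f [By fg fP]]].
  exists (fun i => if (i < N)%N then f i else 0%N), y; split => //.
    move=> i; case: ifP => // iN.
    by have := fg i; rewrite size_mkseq nth_mkseq//; exact.
  move=> j jm; have [|<- <-] := dep j f (fun i => if (i < N)%N then f i else 0%N).
  - by move=> i ij; rewrite ifT// (leq_trans ij)// NP.
  - exact: fP.
have mL : measurable (\bigcap_m D m) by exact: bigcapT_measurable.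
exists (\bigcap_m D m); split => //.
  (* The witnesses of [x] in the [D m] yield one branch [h] by [konig]. Their second coordinates
     have a cluster point in the compact [B n0], and it lies in every closed [K j h]. *)
  move=> x xD; have /choice[fy fyP] : forall m, exists fy : (nat -> nat) * Y,
      [/\ forall i, (fy.1 i <= g i)%N, B n0 fy.2 &
          forall j, (j < m)%N -> F j fy.1 x /\ K j fy.1 fy.2].
    by move=> m; have [f [y fyP]] := xD m I; exists (f, y).
  have [h hP] := @konig (fun m => (fy m).1) g (fun m i => let: And3 a _ _ := fyP m in a i).
  have /choice[y yP] : forall m, exists y, B n0 y /\
      forall j, (j < m)%N -> F j h x /\ K j h y.
    move=> m; have [N NP] := initial_segment_bound m n.
    have [m' mm' m'P] := hP N m; case: (fyP m') => _ By yP.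
    exists (fy m').2; split => // j jm.
    have [<- <-] := dep j (fy m').1 h (fun i ij => m'P i (leq_trans ij (NP j jm))).
    exact: yP (leq_trans jm mm').
  have [y0 [By0 cy0]] : B n0 `&` cluster (y @ \oo) !=set0.
    by apply: cptB; exists 0%N => // m _; case: (yP m).
  exists y0; apply/AE; exists h => j; split.
    by case: (yP j.+1) => _ /(_ j (ltnSn j))[].
  apply: cK => W nW; apply: cy0 => //; exists j.+1 => // m jm.
  by case: (yP m) => _ /(_ j jm)[].
have Ddecr : {homo D : n m / (n <= m)%N >-> (m <= n)%O}.
  move=> a b ab; rewrite subsetEset => x [f [y [fg By fP]]].
  by exists f, y; split => // j ja; apply: fP; exact: leq_trans ab.
have cD : (mu \o D) @ \oo --> mu (\bigcap_m D m).
  apply: nonincreasing_cvg_mu => //.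
  by apply: le_lt_trans mu_fin; apply: le_measure; rewrite ?inE.
rewrite -(cvg_lim _ cD)//; apply: lime_ge.
  by apply/cvg_ex; exists (mu (\bigcap_m D m)).
by near=> m; exact: Dc.
Unshelve. all: by end_near. Qed.

(** The infimum [a] of the thin bounds is the outer measure of the projection. No bound below [a] is
    thin, so inner sets of measure at least [a - 1/(n+1)] exist; their union and the intersection of
    near-optimal covers both have the finite measure [a]. *)
Lemma suslin_proj_ae (A : set (X * Y)) : suslin A ->
  exists L U, [/\ measurable L, measurable U,
    L `<=` [set x | exists y, A (x, y)], [set x | exists y, A (x, y)] `<=` U &
    mu (U `\` L) = 0%E].
Proof.
move=> sA; set PA := [set x | _].
pose T := [set c | thin c PA].
have muT : mu setT \is a fin_num by rewrite ge0_fin_numE.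
have T0 : T !=set0 by exists (fine (mu setT)), setT; rewrite fineK.
have Tlb : lbound T 0 by move=> c [U [mU _]]; rewrite -lee_fin; exact: le_trans.
have hT : has_inf T by split => //; exists 0.
pose a := inf T.
have e0 n : 0 < n.+1%:R^-1 :> R by rewrite invr_gt0.
have /choice[U UP] : forall n : nat, exists U,
    [/\ measurable U, PA `<=` U & (mu U <= (a + n.+1%:R^-1)%:E)%E].
  move=> n; have [c [U [mU AU Uc]] ca] := inf_adherent (e0 n) hT.
  by exists U; split => //; rewrite (le_trans Uc)// lee_fin ltW.
have /choice[L LP] : forall n : nat, exists L,
    [/\ measurable L, L `<=` PA & ((a - n.+1%:R^-1)%:E <= mu L)%E].
  move=> n; apply: suslin_proj_inner => //.
  move=> /(ge_inf hT.2); rewrite -/a lerBrDr gerDl.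
  by rewrite leNgt e0.
have mU : measurable (\bigcap_n U n) by apply: bigcapT_measurable => n; case: (UP n).
have mL : measurable (\bigcup_n L n) by apply: bigcupT_measurable => n; case: (LP n).
have LU : \bigcup_n L n `<=` \bigcap_n U n.
  move=> x [k _ Lx] m _; case: (UP m) => _ + _; apply.
  by case: (LP k) => _ + _; apply.
exists (\bigcup_n L n), (\bigcap_n U n); split => //.
- by move=> x [n _]; case: (LP n) => _ + _; exact.
- by move=> x Ax n _; case: (UP n) => _ + _; exact.
have fin W : measurable W -> mu W \is a fin_num.
  move=> mW; rewrite ge0_fin_numE//; apply: le_lt_trans mu_fin.
  by apply: le_measure; rewrite ?inE.
have Ua : (mu (\bigcap_n U n) <= a%:E)%E.
  apply/lee_addgt0Pr => e e_gt0.
  have [n _ /(_ n (leqnn n)) /= ne] := near_infty_natSinv_lt (PosNum e_gt0).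
  case: (UP n) => mUn _ Un; apply: (@le_trans _ _ (mu (U n))).
    by apply: le_measure; rewrite ?inE// => x; exact.
  by rewrite (le_trans Un)// -EFinD lee_fin lerD2l ltW.
have La : (a%:E <= mu (\bigcup_n L n))%E.
  apply/lee_addgt0Pr => e e_gt0.
  have [n _ /(_ n (leqnn n)) /= ne] := near_infty_natSinv_lt (PosNum e_gt0).
  case: (LP n) => mLn _ Ln.
  have : (mu (L n) <= mu (\bigcup_n L n))%E.
    by apply: le_measure; rewrite ?inE// => x; exists n.
  move=> /(le_trans Ln); rewrite -(fineK (fin _ mL)) -EFinD !lee_fin lerBlDr => /le_trans; apply.
  by rewrite lerD2l ltW.
apply/eqP; rewrite eq_le measure_ge0 andbT measureD//; last by rewrite -ge0_fin_numE// fin.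
rewrite (setIidr LU) lee_subel_addr ?fin// add0e.
exact: le_trans La.
Qed.

End projection.

(** * Borel sets of R^p *)

(** The closed pieces consist of the points at distance at least [1/(n+1)] from the complement. *)
Lemma open_Fsigma {R : realType} {V : normedModType R} (U : set V) :
  open U -> Fsigma U.
Proof.
move=> oU.
exists (fun n => [set y | forall z, ~ U z -> n.+1%:R^-1 <= `|y - z|]).
  move=> n y cy z nUz; rewrite leNgt; apply/negP => yz.
  have e0 : 0 < n.+1%:R^-1 - `|y - z| by rewrite subr_gt0.
  have [y' /= [Hy' By']] := cy _ (nbhsx_ballx y _ e0).
  have := Hy' z nUz; apply/negP; rewrite -ltNge.
  rewrite (le_lt_trans (ler_distD y _ _))// -ltrBrDr distrC.
  by move: By'; rewrite -ball_normE.
apply/seteqP; split => y.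
  move=> Uy; have /nbhs_ballP[e /= e_gt0 yU] := open_nbhs_nbhs (conj oU Uy).
  have [n _ /(_ n (leqnn n)) /= ne] := near_infty_natSinv_lt (PosNum e_gt0).
  exists n => // z nUz; rewrite leNgt; apply/negP => yz; apply: nUz; apply: yU.
  by rewrite -ball_normE; exact: lt_trans ne.
move=> [n _ yP]; apply: contrapT => /yP.
by rewrite subrr normr0 leNgt invr_gt0 ltr0n.
Qed.

Section rVborel.
Context {R : realType}.

Lemma rVball_compact p n : compact [set u : 'rV[R]_p | `|u| <= n%:R].
Proof.
apply: bounded_closed_compact.
  exists n%:R; split; first exact: num_real.
  by move=> M nM u /= /le_trans; apply; exact: ltW.
move=> u cu /=; rewrite leNgt; apply/negP => nu.
have e0 : 0 < `|u| - n%:R by rewrite subr_gt0.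
have [v /= [vn]] := cu _ (nbhsx_ballx u _ e0).
rewrite -ball_normE /= => uv.
have := ler_normD (u - v) v; rewrite subrK leNgt => /negP; apply.
by rewrite -ltrBrDr (lt_le_trans uv)// lerB.
Qed.

Lemma rVball_cover p : \bigcup_n [set u : 'rV[R]_p | `|u| <= n%:R] = setT.
Proof.
apply/seteqP; split => // u _; exists (Num.truncn `|u|).+1 => //=.
by rewrite ltW// truncnS_gt.
Qed.

Lemma projection_ae {d} {X : measurableType d} {p}
    (mu : {measure set X -> \bar R}) (A : set (X * rVborel R p)) :
  (mu setT < +oo)%E -> measurable A ->
  exists L U, [/\ measurable L, measurable U,
    L `<=` [set x | exists y, A (x, y)], [set x | exists y, A (x, y)] `<=` U &
    mu (U `\` L) = 0%E].
Proof.
move=> mufin mA.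
have sA : suslin (A : set (X * 'rV[R]_p)).
  by apply: measurable_suslin => // U; exact: open_Fsigma.
apply: (suslin_proj_ae mufin _ _ _ sA) => [n||].
- exact: (@rVball_compact p n).
- by move=> n u /= /le_trans; apply; rewrite ler_nat.
- exact: rVball_cover.
Qed.

(** The sigma-algebra on rows is generated by open sets, not by coordinates. An open set is a
    countable union of compact sets, each covered by finitely many balls inside the open set, and a
    ball of the sup norm is a box, described by coordinates. *)
Lemma measurable_row {d} {X : measurableType d} k (f : 'I_k -> X -> R) :
  (forall j, measurable_fun setT (f j)) ->
  measurable_fun setT (fun x => \row_j f j x : rVborel R k).
Proof.
move=> mf; pose g x : 'rV[R]_k := \row_j f j x.
apply: (measurability (@open 'rV[R]_k : set (set (rVborel R k)))) => // _ [U oU <-].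
rewrite setTI -/g.
have mball c e : measurable (g @^-1` ball c e).
  have [e0|e0] := ltP 0 e; last first.
    suff -> : g @^-1` ball c e = set0 by exact: measurable0.
    by apply/seteqP; split => x //= -[] /lt_geF; rewrite e0.
  suff -> : g @^-1` ball c e = \bigcap_(j in [set: 'I_k]) (f j @^-1` ball (c 0 j) e).
    apply: fin_bigcap_measurable => // j _; rewrite -[X in measurable X]setTI.
    by apply: mf => //; exact: measurable_ball.
  apply/seteqP; split => x /=.
    by move=> [_ cx] j _; have := cx 0 j; rewrite mxE.
  by move=> xP; split => // i j; rewrite (ord1 i) mxE; exact: xP.
have mcpt C : compact C -> C `<=` U ->
    exists W, [/\ C `<=` W, W `<=` U & measurable (g @^-1` W)].
  rewrite compact_cover => cC CU.
  have /choice[e eP] : forall c, exists e : R, C c -> 0 < e /\ ball c e `<=` U.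
    move=> c; have [Cc|nCc] := pselect (C c); last by exists 0.
    have /nbhs_ballP[e /= e0 eU] := open_nbhs_nbhs (conj oU (CU _ Cc)).
    by exists e.
  have [|c Cc|D DC CD] := cC _ C (fun c => ball c (e c)).
  - by move=> c Cc; apply: ball_open; case: (eP c Cc).
  - by exists c => //; apply: ballxx; case: (eP c Cc).
  exists (\bigcup_(c in [set` D]) ball c (e c)); split => //.
    move=> u [c /= cD cu]; case: (eP c) => [|_]; last exact.
    by have := DC _ cD; rewrite inE.
  by rewrite preimage_bigcup; apply: fin_bigcup_measurable.
have [F cF UF] := open_Fsigma oU.
have /choice[W WP] : forall nm : nat * nat, exists W,
    [/\ F nm.1 `&` [set u | `|u| <= nm.2%:R] `<=` W, W `<=` U & measurable (g @^-1` W)].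
  move=> [n m]; apply: mcpt => /=; last by rewrite UF => u [? _]; exists n.
  rewrite setIC; apply: compact_closedI => //; exact: rVball_compact.
suff -> : U = \bigcup_nm W nm.
  by rewrite preimage_bigcup; apply: countable_bigcupT_measurable => // nm; case: (WP nm).
apply/seteqP; split => u.
  rewrite UF => -[n _ Fu]; have : [set: 'rV[R]_k] u by [].
  rewrite -rVball_cover => -[m _ um]; exists (n, m) => //.
  by case: (WP (n, m)) => + _ _; apply.
by move=> [nm _]; case: (WP nm) => _ + _; apply.
Qed.

Lemma continuous_rV_measurable p (f : 'rV[R]_p -> R) :
  continuous f -> measurable_fun [set: rVborel R p] f.
Proof.
move=> cf; apply: (measurability _ (RGenOInfty.measurableE R)) => _ [_ [x ->] <-].
rewrite setTI; apply: sub_sigma_algebra.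
by move/continuousP: cf; apply; exact: rray_open.
Qed.

Lemma measurable_coord p j :
  measurable_fun setT ((fun u => u 0 j) : rVborel R p -> R).
Proof. by apply: continuous_rV_measurable; exact: coord_continuous. Qed.

Lemma measurable_dotp p :
  measurable_fun setT (fun us : rVborel R p * rVborel R p => dotp us.1 us.2).
Proof.
rewrite /dotp; apply: measurable_sum => j; apply: measurable_funM.
  exact: (measurableT_comp (measurable_coord j) measurable_fst).
exact: (measurableT_comp (measurable_coord j) measurable_snd).
Qed.

Lemma measurable_opp_rV p :
  measurable_fun setT (fun u : rVborel R p => - (u : 'rV[R]_p) : rVborel R p).
Proof.
have -> : (fun u : rVborel R p => - (u : 'rV[R]_p) : rVborel R p) =
    fun u => \row_j (- ((u : 'rV[R]_p) 0 j)).
  by apply/funext => u; apply/rowP => j; rewrite !mxE.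
by apply: measurable_row => j; apply: measurableT_comp => //; exact: measurable_coord.
Qed.

End rVborel.

(** * Processes driven by a reflection-invariant random element *)

(** [limn] takes a default value at divergent sequences. The Cauchy criterion with countable
    quantifiers makes the convergence set measurable; the limit is measurable on it and constant off
    it. *)
Lemma measurable_fun_limn {d} {X : measurableType d} {R : realType}
    (h : nat -> X -> R) :
  (forall n, measurable_fun setT (h n)) ->
  measurable_fun setT (fun x => limn (h ^~ x)).
Proof.
move=> mh.
pose C := \bigcap_k \bigcup_N \bigcap_i
  [set x | `|h N x - h (N + i)%N x| < k.+1%:R^-1].
have mC : measurable C.
  apply: bigcapT_measurable => k; apply: bigcupT_measurable => N.
  apply: bigcapT_measurable => i; rewrite -[X in measurable X]setTI.
  apply: (measurable_fun_ltr _ _ _ (Y := [set true])) => //.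
  by apply: measurableT_comp => //; exact: measurable_funB.
have CE x : C x <-> cvgn (h ^~ x).
  split=> [Cx|/cvg_ex[l hl] k _].
    apply: R_complete; apply: cauchy_exP => e e0.
    have [k _ /(_ k (leqnn k)) /= ke] := near_infty_natSinv_lt (PosNum e0).
    have [N _ NP] := Cx k I; exists (h N x); exists N => // n /= Nn.
    by rewrite -ball_normE /=; apply: lt_trans ke; have := NP (n - N)%N I; rewrite /= subnKC.
  have e0 : 0 < k.+1%:R^-1 / 2 :> R by rewrite divr_gt0.
  have /cvgrPdist_lt/(_ _ e0)[N _ NP] := hl.
  exists N => // i _ /=; rewrite (le_lt_trans (ler_distD l _ _))//.
  rewrite [ltRHS]splitr ltrD//; first by rewrite distrC; exact: NP N (leqnn N).
  by apply: NP => /=; exact: leq_addr.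
rewrite -(setUv C); apply/measurable_funU => //; first exact: measurableC.
split.
  apply: (measurable_fun_cvg (h := h)) => [n|x /CE //].
  exact: measurable_funTS.
apply: (eq_measurable_fun (cst point)); last exact: measurable_cst.
by move=> x; rewrite inE => nCx; rewrite dvgP// => /CE.
Qed.

Lemma measure_eq_off_negligible {d} {X : measurableType d} {R : realType}
    (mu : {measure set X -> \bar R}) (A B N : set X) :
  measurable A -> measurable B -> mu.-negligible N ->
  (forall x, ~ N x -> A x <-> B x) -> mu A = mu B.
Proof.
move=> mA mB [N' [mN' N'0 NN']] AB.
have le A' B' : measurable A' -> measurable B' ->
    (forall x, ~ N x -> A' x -> B' x) -> (mu A' <= mu B')%E.
  move=> mA' mB' AB'; apply: (@le_trans _ _ (mu (B' `|` N'))).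
    apply: le_measure; rewrite ?inE//; first exact: measurableU.
    move=> x Ax; have [/NN'|nNx] := pselect (N x); first by right.
    by left; exact: AB' Ax.
  apply: (le_trans (measureU2 mu mB' mN')).
  by rewrite [X in (_ + X)%E](_ : _ = 0%E) ?adde0.
by apply/eqP; rewrite eq_le !le// => x /AB[].
Qed.

(** * Measurability of the minimizer event up to null sets *)

Lemma rat_between {R : realType} (x y : \bar R) : (x < y)%E ->
  exists q : rat, (x < (ratr q)%:E)%E /\ ((ratr q)%:E < y)%E.
Proof.
have D (a b : R) : a < b -> exists q : rat, a < ratr q /\ ratr q < b.
  by move=> /rat_in_itvoo[q]; rewrite in_itv /= => /andP[? ?]; exists q.
case: x y => [x| |] [y| |] //.
- by rewrite lte_fin => /D[q [? ?]]; exists q; rewrite !lte_fin.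
- have /D[q [? _]] : x < x + 1 by rewrite ltrDl.
  by exists q; rewrite lte_fin ltry.
- have /D[q [_ ?]] : y - 1 < y by rewrite ltrBlDr ltrDl.
  by exists q; rewrite lte_fin ltNyr.
- by exists 0; rewrite ltNyr ltry.
Qed.

(** A point [u] minimizes [f (z, .)] iff [f (z, u) < q] for every rational [q] above some value
    [f (z, v)]. Countably many projections eliminate [v], and a last one eliminates [u]. *)
Lemma argmin_ae {d} {E : measurableType d} {R : realType} {p}
    (mu : {measure set E -> \bar R}) (f : E * rVborel R p -> \bar R)
    (B : set (rVborel R p)) :
  (mu setT < +oo)%E -> measurable_fun setT f -> measurable B ->
  exists S N, [/\ measurable S, measurable N, mu N = 0%E &
    forall z, ~ N z -> S z <-> exists2 u, B u & argmin (fun u => f (z, u)) u].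
Proof.
move=> mufin mf mB.
pose r n : R := ratr (odflt 0 (choice.unpickle n) : rat).
pose A n := [set zu | (f zu < (r n)%:E)%E].
have mA n : measurable (A n).
  rewrite /A -[X in measurable X]setTI.
  by apply: (measurable_fun_lte _ _ _ (Y := [set true])) => //; exact: measurable_cst.
have /choice[LU LUP] : forall n, exists LU : set E * set E,
    [/\ measurable LU.1, measurable LU.2,
    LU.1 `<=` [set z | exists u, A n (z, u)],
    [set z | exists u, A n (z, u)] `<=` LU.2 & mu (LU.2 `\` LU.1) = 0%E].
  by move=> n; have [L [U ?]] := projection_ae mufin (mA n); exists (L, U).
pose M := \bigcup_n ((LU n).2 `\` (LU n).1).
have mD n : measurable ((LU n).2 `\` (LU n).1).
  by case: (LUP n) => *; exact: measurableD.
have mM : measurable M by exact: bigcupT_measurable.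
have M0 : mu M = 0%E.
  apply: measure_negligible => //; apply: negligible_bigcup => n.
  by apply/negligibleP => //; case: (LUP n).
(* Off [M], [(LU n).2] is exactly the set of [z] for which some value of [f (z, .)] is below
   [r n]. *)
pose G := \bigcap_n (~` ((LU n).2 `*` setT) `|` A n) `&` (setT `*` B).
have mG : measurable G.
  apply: measurableI; last exact: measurableX.
  apply: bigcapT_measurable => n; apply: measurableU => //.
  by apply: measurableC; apply: measurableX => //; case: (LUP n).
have GE z u : ~ M z -> G (z, u) <-> B u /\ argmin (fun u => f (z, u)) u.
  move=> nM; split.
    move=> [GA [_ Bu]]; split => // v; rewrite leNgt; apply/negP.
    move=> /rat_between[q [vq qu]].
    have rq : r (choice.pickle q) = ratr q by rewrite /r choice.pickleK.
    case: (GA (choice.pickle q) I) => /=; last first.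
      by rewrite /A /= rq => /(lt_trans qu); rewrite ltxx.
    apply; split => //; case: (LUP (choice.pickle q)) => _ _ _ + _; apply.
    by exists v; rewrite /A /= rq.
  move=> [Bu um]; split => // n _.
  have [[v Av]|nA] := pselect (exists v, A n (z, v)).
    by right; apply: le_lt_trans Av; exact: um.
  left => -[/= zU _]; apply: nM; exists n => //; split => //.
  by case: (LUP n) => _ _ + _ _ => /[apply].
have [L [U [mL mU LG GU UL0]]] := projection_ae mufin mG.
exists U, (M `|` (U `\` L)); split => //.
- by apply: measurableU => //; exact: measurableD.
- apply/eqP; rewrite eq_le measure_ge0 andbT.
  apply: (le_trans (measureU2 mu mM (measurableD mU mL))).
  by rewrite [X in (X + _)%E](_ : _ = 0%E)// add0e [leLHS](_ : _ = 0%E).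
move=> z /not_orP[nM nUL]; split.
  move=> Uz; have Lz : L z by apply: contrapT => nL; exact: nUL.
  by have [u /(GE _ _ nM)[Bu um]] := LG z Lz; exists u.
by move=> [u Bu um]; apply: GU; exists u; apply/(GE _ _ nM).
Qed.

(* The process is a jointly measurable function [G] of a random
   element [Z] and of [u], and replacing [u] by [- u] amounts to applying to [Z]
   a map [T] that preserves its law. *)
Section reflection.
Context {R : realType} {p : nat} {d : measure_display} {Omega : measurableType d}.
Variable P : probability Omega R.
Context {dE : measure_display} {E : measurableType dE}.
Variables (Z : Omega -> E) (T : E -> E).
Hypotheses (mZ : measurable_fun setT Z) (mT : measurable_fun setT T).
Hypothesis lawT : forall A, measurable A -> P (Z @^-1` A) = P (Z @^-1` (T @^-1` A)).

Definition reflects (G : E * rVborel R p -> R) :=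
  measurable_fun setT G /\ forall z (u : 'rV[R]_p), G (z, - u) = G (T z, u).

Let measurableZ A : measurable A -> measurable (Z @^-1` A).
Proof. by move=> mA; rewrite -[X in measurable X]setTI; exact: mZ. Qed.

Let measurableT' A : measurable A -> measurable (T @^-1` A).
Proof. by move=> mA; rewrite -[X in measurable X]setTI; exact: mT. Qed.

Lemma reflects_even G : reflects G -> even_process P (fun u w => G (Z w, u)).
Proof.
move=> [mG GT] k k0 u.
pose F z : rVborel R k := \row_j G (z, u j).
have mF : measurable_fun setT F.
  apply: measurable_row => j; apply: (measurableT_comp mG).
  by apply: measurable_fun_pair => //; exact: measurable_cst.
have FT : (fun w => \row_j G (Z w, - u j)) = F \o T \o Z.
  by apply/funext => w; apply/rowP => j; rewrite !mxE GT.
split; rewrite ?FT.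
- exact: (measurableT_comp mF mZ).
- by apply: measurableT_comp => //; exact: measurableT_comp.
- move=> B mB; rewrite -[LHS]/(P (Z @^-1` (F @^-1` B))) lawT//.
  by rewrite -[X in measurable X]setTI; exact: mF.
Qed.

(** Positive and negative parts are treated separately: their integrals, possibly infinite, depend
    only on the common law of [Z] and [T \o Z]. *)
Lemma reflects_expectation G (u : 'rV[R]_p) : reflects G ->
  ('E_P[fun w => G (Z w, (- u)%R)] = 'E_P[fun w => G (Z w, u)])%E.
Proof.
move=> [mG GT]; rewrite expectation.unlock.
pose h z := (G (z, u))%:E.
have mh : measurable_fun setT h.
  apply/measurable_EFinP; apply: (measurableT_comp mG).
  by apply: measurable_fun_pair => //; exact: measurable_cst.
have TZ : (fun w => (G (Z w, - u))%:E) = h \o (T \o Z).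
  by apply/funext => w; rewrite /= GT.
have mTZ : measurable_fun setT (T \o Z) by exact: measurableT_comp.
rewrite TZ [LHS]integralE [RHS]integralE.
have key k : measurable_fun setT k -> (forall z, 0 <= k z)%E ->
    (\int[P]_w (k ((T \o Z) w)) = \int[P]_w (k (Z w)))%E.
  move=> mk k0.
  rewrite -[LHS](ge0_integral_pushforward mTZ P (D := setT))//.
  rewrite -[RHS](ge0_integral_pushforward mZ P (D := setT))//.
  by apply: eq_measure_integral => A mA _; rewrite /= /pushforward lawT.
have comp_pos (k : Omega -> E) : (h \o k)^\+%E = h^\+%E \o k.
  by apply/funext => w; rewrite /= !funeposE.
have comp_neg (k : Omega -> E) : (h \o k)^\-%E = h^\-%E \o k.
  by apply/funext => w; rewrite /= !funenegE.
rewrite -[X in _ = (\int[P]_x X^\+%E x - _)%E]/(h \o Z).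
rewrite -[X in _ = (_ - \int[P]_x X^\-%E x)%E]/(h \o Z) !comp_pos !comp_neg.
congr (_ - _)%E.
- by apply: (key (h^\+)%E (measurable_funepos mh)) => z; exact: funepos_ge0.
- by apply: (key (h^\-)%E (measurable_funeneg mh)) => z; exact: funeneg_ge0.
Qed.

(** Tonelli for the positive and the negative part; this keeps the centered process jointly
    measurable. *)
Lemma measurable_fine_expectation G : measurable_fun setT G ->
  measurable_fun [set: rVborel R p] (fun u => fine ('E_P[fun w => G (Z w, u)])%E).
Proof.
move=> mG; rewrite expectation.unlock.
apply: (measurableT_comp (fine_measurable measurableT)).
pose F (uw : rVborel R p * Omega) := (G (Z uw.2, uw.1))%:E.
have mF : measurable_fun setT F.
  apply/measurable_EFinP; apply: (measurableT_comp mG); apply: measurable_fun_pair => //.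
  exact: (measurableT_comp mZ measurable_snd).
under eq_fun do rewrite integralE.
apply: emeasurable_funB.
- apply: (eq_measurable_fun (fubini_F P F^\+%E)) => [u _|].
    by apply: eq_integral => w _; rewrite !funeposE.
  apply: measurable_fun_fubini_tonelli_F => [|uw]; first exact: measurable_funepos.
  exact: funepos_ge0.
- apply: (eq_measurable_fun (fubini_F P F^\-%E)) => [u _|].
    by apply: eq_integral => w _; rewrite !funenegE.
  apply: measurable_fun_fubini_tonelli_F => [|uw]; first exact: measurable_funeneg.
  exact: funeneg_ge0.
Qed.

Lemma reflects_centered G : reflects G ->
  reflects (fun zu => G zu - fine ('E_P[fun w => G (Z w, zu.2)])%E).
Proof.
move=> rG; have [mG GT] := rG; split.
  apply: measurable_funB => //.
  exact: (measurableT_comp (measurable_fine_expectation mG) measurable_snd).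
by move=> z u /=; rewrite reflects_expectation// GT.
Qed.

(** Almost surely, [W] is in [B] iff [Z] is in the set [S] of [argmin_ae]. Minimizers for [T z] are
    the negatives of those for [z], so [- W] is in [B] iff [T (Z w)] is in [S], an event of the same
    probability. *)
Lemma reflects_argmin G (g : rVborel R p -> \bar R) (W : Omega -> rVborel R p) :
  reflects G -> measurable_fun setT g -> even_fun g -> measurable_fun setT W ->
  {ae P, forall w, argmin (fun u => g u + (G (Z w, u))%:E)%E = [set W w]} ->
  eq_in_law P W (fun w => - W w : 'rV[R]_p).
Proof.
move=> [mG GT] mg eg mW aeW.
pose f (zu : E * rVborel R p) := (g zu.2 + (G zu)%:E)%E.
have mf : measurable_fun setT f.
  apply: emeasurable_funD; last exact/measurable_EFinP.
  exact: (measurableT_comp mg measurable_snd).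
have fT z (u : 'rV[R]_p) : f (z, - u) = f (T z, u) by rewrite /f /= GT eg.
have argminT z (u : 'rV[R]_p) :
    argmin (fun v => f (T z, v)) u <-> argmin (fun v => f (z, v)) (- u).
  split => um v; have /= := um (- v : 'rV[R]_p).
    by rewrite -!fT opprK.
  by rewrite !fT.
have mNW : measurable_fun setT (fun w => (- (W w : 'rV[R]_p)) : rVborel R p).
  exact: (measurableT_comp (@measurable_opp_rV R p) mW).
split => // B mB.
have fin : (pushforward P Z setT < +oo)%E.
  by rewrite /pushforward preimage_setT probability_setT ltry.
have [S [N [mS mN N0 SP]]] := argmin_ae fin mf mB.
have [N' [mN' N'0 NN']] := aeW.
have negZ A : measurable A -> P A = 0%E -> P.-negligible
    (~` [set w | argmin (fun u => g u + (G (Z w, u))%:E)%E = [set W w]] `|` A).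
  move=> mA A0; apply: negligibleU => //; exact/negligibleP.
transitivity (P (Z @^-1` S)).
  apply: (@measure_eq_off_negligible _ _ _ P _ _ _ _ _ (negZ _ (measurableZ mN) N0)).
  - by rewrite -[X in measurable X]setTI; exact: mW.
  - exact: measurableZ.
  - move=> w /not_orP[/contrapT /= aw nN]; apply: iff_trans (iff_sym (SP _ nN)).
    rewrite [argmin _]aw; split; first by exists (W w).
    by move=> [u Bu <-].
rewrite lawT//; apply/esym.
(* The exceptional set is null for the law of [Z], hence also for that of [T \o Z]. *)
have NT0 : P (Z @^-1` (T @^-1` N)) = 0%E by rewrite -lawT.
apply: (@measure_eq_off_negligible _ _ _ P _ _ _ _ _
  (negZ _ (measurableZ (measurableT' mN)) NT0)).
- by rewrite -[X in measurable X]setTI; exact: mNW.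
- by apply: measurableZ; exact: measurableT'.
- move=> w /not_orP[/contrapT /= aw nN]; apply: iff_trans (iff_sym (SP _ nN)); split.
    by move=> BW; exists (- W w : 'rV[R]_p) => //; apply/argminT; rewrite opprK aw.
  move=> [u Bu] /argminT; rewrite [argmin _]aw /= => <-.
  by rewrite opprK.
Qed.

End reflection.

(** * Sequence spaces and the Poisson hyperplane process *)

(** Uniqueness of finite measures on a generating pi-system, applied to the two push-forwards of
    [P]. *)
Lemma eq_law_generator {d} {Omega : measurableType d} {R : realType}
    (P : probability Omega R) {d'} {E : measurableType d'} (f g : Omega -> E)
    (G : set (set E)) :
  measurable_fun setT f -> measurable_fun setT g ->
  @measurable _ E = <<s G >> -> setI_closed G -> G setT ->
  (forall A, G A -> P (f @^-1` A) = P (g @^-1` A)) ->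
  forall A, measurable A -> P (f @^-1` A) = P (g @^-1` A).
Proof.
move=> mf mg GE GI GT PG A mA.
have cov : \bigcup_(k in [set: nat]) (fun _ : nat => [set: E]) k = setT.
  by rewrite bigcup_const //; exists 0%N.
have fin : (nat -> pushforward P f setT < +oo)%E.
  by rewrite /pushforward preimage_setT probability_setT ltry.
exact: (@measure_unique _ _ _ G (fun=> setT) GE GI (fun=> GT) cov (pushforward P f)
  (pushforward P g) PG fin A mA).
Qed.

Section sequences.
Context {d : measure_display} {T : measurableType d}.

(** Finite-dimensional rectangles, in the form in which [mutually_independent] tests them. *)
Definition cylinder (C : set (nat -> T)) :=
  exists (J : {fset nat}) (B : nat -> set T), (forall i, measurable (B i)) /\
    C = \bigcap_(i in [set` J]) [set x | B i (x i)].

Definition seq_space := g_sigma_algebraType cylinder.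

Lemma cylinderT : cylinder setT.
Proof.
exists fset0, (fun=> setT); split => //.
by apply/seteqP; split => // x _ i _.
Qed.

Lemma cylinderI : setI_closed cylinder.
Proof.
move=> _ _ [J [B [mB ->]]] [J' [B' [mB' ->]]].
exists (J `|` J')%fset, (fun i => (if i \in J then B i else setT) `&`
  (if i \in J' then B' i else setT)); split.
  by move=> i; apply: measurableI; case: ifP.
apply/seteqP; split => x.
  move=> [xB xB'] i _ /=; split; case: ifP => // iJ; [exact: xB|exact: xB'].
move=> xB; split => i iJ.
  by have /= := xB i; rewrite in_fsetU iJ /= => /(_ isT)[].
by have /= := xB i; rewrite in_fsetU iJ orbT => /(_ isT)[].
Qed.

Lemma measurable_nth i : measurable_fun setT ((fun x => x i) : seq_space -> T).
Proof.
move=> _ B mB; rewrite setTI; apply: sub_sigma_algebra.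
exists [fset i]%fset, (fun=> B); split => //.
apply/seteqP; split => x /=; first by move=> Bx j /=; rewrite inE => /eqP ->.
by apply; rewrite /= inE.
Qed.

Lemma measurable_seq {d'} {X : measurableType d'} (f : nat -> X -> T) :
  (forall i, measurable_fun setT (f i)) ->
  measurable_fun setT (fun x => (fun i => f i x) : seq_space).
Proof.
move=> mf; apply: (measurability (cylinder : set (set seq_space))) => // _ [_ [J [B [mB ->]]] <-].
rewrite setTI preimage_bigcap; apply: fin_bigcap_measurable => // i _.
by rewrite -[X in measurable X]setTI; exact: mf.
Qed.

(** [Omega] is given the sigma-algebra generated by the [X i], for which the whole sequence is
    measurable. Independence can then be applied to events of the sequence space. *)
Lemma sigma_of_seq_preimage {d'} {Omega : measurableType d'} (X : nat -> Omega -> T)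
    (B : set seq_space) : measurable B ->
  sigma_of_seq X ((fun w i => X i w) @^-1` B).
Proof.
move=> mB; pose G := \bigcup_i preimage_set_system setT (X i) measurable.
have mX i : measurable_fun [set: g_sigma_algebraType G] (X i).
  move=> _ C mC; apply: sub_sigma_algebra; exists i => //.
  by exists C.
have := measurable_seq mX measurableT mB; rewrite setTI; exact.
Qed.

End sequences.
Arguments seq_space {d} T.

(** * Reflection of the driving sequences *)

Section driver.
Context {R : realType} {p : nat}.
Implicit Type nu : probability (R * rVborel R p)%type R.

Definition flip (z : R * rVborel R p) : R * rVborel R p := (z.1, - (z.2 : 'rV[R]_p)).

Lemma measurable_flip : measurable_fun setT flip.
Proof.
apply: measurable_fun_pair => //.
exact: (measurableT_comp (@measurable_opp_rV R p) measurable_snd).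
Qed.

(** The symmetry assumed on rectangles extends to all measurable sets, since rectangles form a
    generating pi-system. *)
Lemma symmetric_flip nu (A : set (R * rVborel R p)) :
  symmetric_second nu -> measurable A -> nu A = nu (flip @^-1` A).
Proof.
move=> nu_sym; apply: (eq_law_generator (P := nu) (f := id)
  (G := [set A1 `*` A2 | A1 in measurable & A2 in measurable])) => //.
- exact: measurable_flip.
- exact: measurable_prod_measurableType.
- move=> _ _ [A1 mA1 [A2 mA2 <-]] [B1 mB1 [B2 mB2 <-]].
  exists (A1 `&` B1); first exact: measurableI.
  exists (A2 `&` B2); first exact: measurableI.
  by rewrite setXI.
- by exists setT => //; exists setT => //; rewrite setXTT.
- move=> _ [A1 mA1 [A2 mA2 <-]]; rewrite [LHS]nu_sym//; congr (nu _).
  apply/seteqP; split => -[v s] /=.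
    by move=> [A1v [t A2t ->]]; rewrite /flip /= opprK.
  by move=> [A1v A2s]; split => //; exists (- s) => //; rewrite opprK.
Qed.

Definition flip_seq (tx : seq_space R * seq_space (R * rVborel R p)%type) :
    seq_space R * seq_space (R * rVborel R p)%type :=
  (tx.1, fun i => flip (tx.2 i)).

Lemma measurable_flip_seq : measurable_fun setT flip_seq.
Proof.
apply: measurable_fun_pair => //; apply: measurable_seq => i.
apply: (measurableT_comp measurable_flip).
exact: (measurableT_comp (measurable_nth i) measurable_snd).
Qed.

(** The product formula on cylinders shows that flipping each term preserves the law of [VU].
    Independence from [tau] then gives the joint law on rectangles, hence everywhere. *)
Lemma driver_law_flip {d} {Omega : measurableType d} (P : probability Omega R) nu
    (tau : nat -> Omega -> R) (VU : nat -> Omega -> R * rVborel R p) :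
  symmetric_second nu -> iid P VU nu -> (forall i, measurable_fun setT (tau i)) ->
  independent_seqs P tau VU ->
  let Z w : seq_space R * seq_space (R * rVborel R p)%type :=
    ((fun i => tau i w), (fun i => VU i w)) in
  forall A, measurable A -> P (Z @^-1` A) = P (Z @^-1` (flip_seq @^-1` A)).
Proof.
move=> nu_sym [lawVU indepVU] mtau indep Z.
have mVU i : measurable_fun setT (VU i) by case: (lawVU i).
pose X w : seq_space (R * rVborel R p)%type := fun i => VU i w.
have mX : measurable_fun setT X by exact: measurable_seq.
have mZ : measurable_fun setT Z.
  by apply: measurable_fun_pair => //; exact: measurable_seq.
pose X' w : seq_space (R * rVborel R p)%type := fun i => flip (VU i w).
have mX' : measurable_fun setT X'.
  by apply: measurable_seq => i; exact: (measurableT_comp measurable_flip).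
have lawX B : measurable B -> P (X @^-1` B) = P (X' @^-1` B).
  move: B; apply: (@eq_law_generator _ _ _ P _ _ X X'
    (@cylinder _ (R * rVborel R p)%type) mX mX') => //.
  - exact: cylinderI.
  - exact: cylinderT.
  move=> _ [J [C [mC ->]]]; rewrite !preimage_bigcap.
  rewrite [LHS](indepVU J C mC).
  have mfC i : measurable (flip @^-1` C i).
    by rewrite -[X in measurable X]setTI; exact: measurable_flip.
  rewrite [RHS](indepVU J (fun i => flip @^-1` C i) mfC).
  apply: eq_bigr => i _; case: (lawVU i) => _ lawi.
  by rewrite !lawi// -symmetric_flip.
apply: (eq_law_generator (f := Z) (g := flip_seq \o Z)
  (G := [set A1 `*` A2 | A1 in measurable & A2 in measurable])) => //.
- by apply: measurableT_comp => //; exact: measurable_flip_seq.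
- exact: measurable_prod_measurableType.
- move=> _ _ [A1 mA1 [A2 mA2 <-]] [B1 mB1 [B2 mB2 <-]].
  exists (A1 `&` B1); first exact: measurableI.
  exists (A2 `&` B2); first exact: measurableI.
  by rewrite setXI.
- by exists setT => //; exists setT => //; rewrite setXTT.
- move=> _ [A1 mA1 [A2 mA2 <-]].
  have i1 := sigma_of_seq_preimage (X := tau) mA1.
  have mfA2 : measurable ((fun x : seq_space _ =>
      (fun i => flip (x i)) : seq_space (R * rVborel R p)%type) @^-1` A2).
    rewrite -[X in measurable X]setTI; apply: measurable_seq => // i.
    exact: (measurableT_comp measurable_flip (measurable_nth i)).
  rewrite [LHS](indep _ _ i1 (sigma_of_seq_preimage (X := VU) mA2)).
  rewrite [RHS](indep _ _ i1 (sigma_of_seq_preimage (X := VU) mfA2)).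
  by congr (_ * _)%E; exact: lawX.
Qed.

Definition Poisson_seq
    (txu : seq_space R * seq_space (R * rVborel R p)%type * rVborel R p) : R :=
  limn (series (fun i => (txu.1.2 i).1 * (txu.1.1 i <= dotp txu.2 (txu.1.2 i).2)%R%:R)).

Lemma reflects_Poisson_seq : reflects flip_seq Poisson_seq.
Proof.
split.
  apply: measurable_fun_limn => n; rewrite /series /=.
  apply: measurable_sum => i.
  have mx : measurable_fun setT (fun txu :
      seq_space R * seq_space (R * rVborel R p)%type * rVborel R p => txu.1.2 i).
    exact: (measurableT_comp (measurable_nth i)
      (measurableT_comp measurable_snd measurable_fst)).
  apply: measurable_funM; first exact: (measurableT_comp measurable_fst mx).
  apply: (eq_measurable_fun (fun txu :
      seq_space R * seq_space (R * rVborel R p)%type * rVborel R p =>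
      if txu.1.1 i <= dotp txu.2 (txu.1.2 i).2 then 1 else 0 : R)) => [txu _|].
    by case: ifP.
  apply: measurable_fun_ifT => //.
  apply: measurable_fun_ler.
    exact: (measurableT_comp (measurable_nth i)
      (measurableT_comp measurable_fst measurable_fst)).
  apply: (measurableT_comp (@measurable_dotp R p)
    (measurable_fun_pair measurable_snd (measurableT_comp measurable_snd mx))).
(* The two series agree term by term, so their [limn] agree even where it is a default value. *)
move=> [t x] u; congr (limn (series _)); apply/funext => i /=.
rewrite /dotp; congr (_ * (_ <= _)%R%:R).
by apply: eq_bigr => j _; rewrite !mxE mulNr mulrN.
Qed.

End driver.

Lemma measurable_of_gap {R : realType} {d} {Omega : measurableType d}
    (tau : nat -> Omega -> R) :
  (forall i, measurable_fun setT (gap tau i)) -> forall i, measurable_fun setT (tau i).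
Proof.
move=> mgap; elim=> [|i IH]; first exact: mgap 0%N.
have -> : tau i.+1 = (tau i \+ gap tau i.+1)%R.
  by apply/funext => w; rewrite /= addrC subrK.
exact: measurable_funD.
Qed.

Unset Implicit Arguments.
Set Strict Implicit.
Set Printing Implicit Defensive.
Theorem corollary3p5 (R : realType) (p : nat)
  (gamma : R) (gamma_ge0 : 0 <= gamma)
  (nu : probability (R * rVborel R p)%type R)
  (nu_int : poisson_integrable gamma nu)
  (d : measure_display) (Omega : measurableType d) (P : probability Omega R)
  (tau : nat -> Omega -> R) (VU : nat -> Omega -> R * rVborel R p)
  (driver : poisson_driver P gamma nu tau VU)
  (nu_sym : symmetric_second nu) :
  even_process P (Poisson gamma tau VU) /\
  even_process P (cPoisson P gamma tau VU) /\
  (forall (D : 'rV[R]_p -> R) (Theta : set 'rV[R]_p) (W : Omega -> rVborel R p),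
    D 0 = 0 -> (forall u, 0 <= D u) ->
    is_cone Theta ->
    measurable_fun [set: rVborel R p]
      (fun u : rVborel R p => ((D u)%:E + opt_indicator Theta u)%E : \bar R) ->
    even_fun (fun u => ((D u)%:E + opt_indicator Theta u)%E) ->
    measurable_fun [set: Omega] W ->
    {ae P, forall w : Omega,
      argmin (fun u => ((D u)%:E + (cPoisson P gamma tau VU u w)%:E
                        + opt_indicator Theta u)%E) = [set W w]} ->
    eq_in_law P W (fun w => - W w : 'rV[R]_p)).
Proof.
(* Common to both cases below, which differ only in the random element that represents the
   process. *)
have main dE (E : measurableType dE) (Z : Omega -> E) (T : E -> E) G :
    measurable_fun setT Z -> measurable_fun setT T ->
    (forall A, measurable A -> P (Z @^-1` A) = P (Z @^-1` (T @^-1` A))) ->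
    reflects T G -> Poisson gamma tau VU = (fun u w => G (Z w, u)) ->
    even_process P (Poisson gamma tau VU) /\
    even_process P (cPoisson P gamma tau VU) /\
    (forall (D : 'rV[R]_p -> R) (Theta : set 'rV[R]_p) (W : Omega -> rVborel R p),
      measurable_fun [set: rVborel R p]
        (fun u : rVborel R p => ((D u)%:E + opt_indicator Theta u)%E : \bar R) ->
      even_fun (fun u => ((D u)%:E + opt_indicator Theta u)%E) ->
      measurable_fun [set: Omega] W ->
      {ae P, forall w : Omega,
        argmin (fun u => ((D u)%:E + (cPoisson P gamma tau VU u w)%:E
                          + opt_indicator Theta u)%E) = [set W w]} ->
      eq_in_law P W (fun w => - W w : 'rV[R]_p)).
  move=> mZ mT lawT rG PE; rewrite /cPoisson PE.
  have rC := reflects_centered mZ mT lawT rG.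
  split; first exact: (reflects_even mZ mT lawT rG).
  split; first exact: (reflects_even mZ mT lawT rC).
  move=> D Theta W mg eg mW aeW.
  apply: (reflects_argmin mZ mT lawT rC mg eg mW).
  apply: filterS aeW => w <-; congr argmin; apply/funext => u /=.
  by rewrite addeAC.
have [g0|gneq0] := eqVneq gamma 0.
  (* The jump times are unconstrained here, so the zero process is represented over a one-point
     space instead of the sequence space. *)
  have [|||||H1 [H2 H3]] := main _ unit (fun=> tt) id (fun=> 0).
  - exact: measurable_cst.
  - exact: measurable_id.
  - by [].
  - by split => //; exact: measurable_cst.
  - by apply/funext => u; apply/funext => w; rewrite /Poisson g0 eqxx.
  by split => //; split => // D Theta W _ _ _; exact: H3.
have gamma_gt0 : 0 < gamma by rewrite lt_neqAle eq_sym gneq0.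
have [iidVU /(_ gamma_gt0)[[gap_law _] indep]] := driver.
have mtau : forall i, measurable_fun setT (tau i).
  by apply: measurable_of_gap => i; case: (gap_law i).
have mVU i : measurable_fun setT (VU i) by case: (iidVU.1 i).
have [|||||H1 [H2 H3]] := main _ (seq_space R * seq_space (R * rVborel R p)%type)%type
  (fun w => ((fun i => tau i w), (fun i => VU i w)) :
     seq_space R * seq_space (R * rVborel R p)%type)
  flip_seq Poisson_seq.
- by apply: measurable_fun_pair; exact: measurable_seq.
- exact: measurable_flip_seq.
- exact: (driver_law_flip nu_sym iidVU mtau indep).
- exact: reflects_Poisson_seq.
- by apply/funext => u; apply/funext => w; rewrite /Poisson (negbTE gneq0).
by split => //; split => // D Theta W _ _ _; exact: H3.
Qed.
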